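(* Let $f:[0,1]\to\mathbb{R}$ be a differentiable function whose derivative $f':[0,1]\to\mathbb{R}$ is an absolutely continuous function such that $f''\in L_2(0,1)$. Then $$|Q(f;0,1)-P(f;0,1)|\le\sqrt{\frac{47}{23040}-\frac{\sqrt2}{768}}\;\sigma(f'';0,1).$$ This inequality is sharp in the sense that the constant $\sqrt{\frac{47}{23040}-\frac{\sqrt2}{768}}$ cannot be replaced by a smaller one (i.e. by a smaller constant for which the inequality would still hold for all such $f$).
   Context: For $f$ on $[0,1]$, $$Q(f;0,1)=\int_0^1 f(t)\,dt-\left[\frac{\sqrt2}{8}f(0)+\left(1-\frac{\sqrt2}{4}\right)f\left(\tfrac12\right)+\frac{\sqrt2}{8}f(1)\right],$$ $$P(f;0,1)=\frac{1}{96}\left(4-3\sqrt2\right)\left[f'(1)-f'(0)\right].$$ For real-valued $g\in L_2(a,b)$, $\sigma(g;a,b)=\sqrt{(b-a)\,T(g,g)}$, where $T(g,g)=\frac1{b-a}\int_a^b g(t)^2\,dt-\left(\frac1{b-a}\int_a^b g(t)\,dt\right)^2$. In particular $\sigma(g;0,1)=\left(\int_0^1 g(t)^2\,dt-\left(\int_0^1 g(t)\,dt\right)^2\right)^{1/2}$. *)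

(* Defs.v *)
From HB Require Import structures.
From mathcomp Require Import all_boot all_order all_algebra.
From mathcomp Require Import all_classical all_reals all_analysis.

Set Implicit Arguments.
Unset Strict Implicit.
Unset Printing Implicit Defensive.

Import Order.TTheory GRing.Theory Num.Theory.
Import numFieldNormedType.Exports.

Local Open Scope classical_set_scope.
Local Open Scope ring_scope.

(* A function on [a, b] is represented by a total function R -> R of which only
   the values on [a, b] are used. Derivatives are therefore taken relatively to
   a set A, so that they are one-sided at the end points of an interval. *)
Section derivative_on.
Context {R : realType}.
Implicit Types (A : set R) (f : R -> R).

Definition quotients_on A f (x : R) : set_system R :=
  (f y - f x) / (y - x) @[y --> within A x^'].

Definition differentiable_on A f := forall x, A x -> cvg (quotients_on A f x).

(* This is 0 at the points where the limit does not exist. *)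
Definition derivative_on A f (x : R) : R := lim (quotients_on A f x).

End derivative_on.

Section absolute_continuity.
Context {R : realType}.

Definition absolutely_continuous_on (a b : R) (g : R -> R) :=
  forall e : R, 0 < e -> exists2 d : R, 0 < d &
    forall (n : nat) (x y : 'I_n -> R),
      (forall i, [/\ a <= x i, x i <= y i & y i <= b]) ->
      trivIset setT (fun i => `]x i, y i[%classic) ->
      \sum_(i < n) (y i - x i) < d ->
      \sum_(i < n) `|g (y i) - g (x i)| < e.

End absolute_continuity.

Section quadrature.
Context {R : realType}.
Implicit Types f g : R -> R.

(* The restriction \_ extends g by point : R, which is 0. *)
Definition L2_on (a b : R) g :=
  (g \_ `]a, b[ : measurableTypeR R -> R) \in Lfun (@lebesgue_measure R) 2%:E.

Definition chebyshev_T (a b : R) g : R :=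
  (b - a)^-1 * (\int[lebesgue_measure]_(t in `[a, b]) (g t ^+ 2))
  - ((b - a)^-1 * \int[lebesgue_measure]_(t in `[a, b]) g t) ^+ 2.

Definition sigma (a b : R) g : R := Num.sqrt ((b - a) * chebyshev_T a b g).

Definition deriv01 f : R -> R := derivative_on `[0, 1] f.

(* The second derivative of f, meaningful almost everywhere on [0, 1] as soon
   as the first one is absolutely continuous. *)
Definition deriv2_01 f : R -> R := deriv01 (deriv01 f).

Definition Q01 f : R :=
  \int[lebesgue_measure]_(t in `[0, 1]) f t
  - (Num.sqrt 2 / 8 * f 0 + (1 - Num.sqrt 2 / 4) * f (1 / 2)
     + Num.sqrt 2 / 8 * f 1).

Definition P01 f : R :=
  1 / 96 * (4 - 3 * Num.sqrt 2) * (deriv01 f 1 - deriv01 f 0).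

Definition admissible f :=
  [/\ differentiable_on `[0, 1] f,
      absolutely_continuous_on 0 1 (deriv01 f)
    & L2_on 0 1 (deriv2_01 f)].

End quadrature.

(* Main.v *)
From HB Require Import structures.
Require Import Defs.
From mathcomp Require Import all_boot all_order all_algebra.
From mathcomp Require Import all_classical all_reals all_analysis.
From mathcomp Require Import measurable_realfun ring lra.

(** The proof rests on the Peano kernel K of the quadrature rule: the piecewise
    quadratic function on [0, 1] that vanishes at 0 and 1, has second derivative
    1 away from 1 / 2, and whose derivative drops at 1 / 2 by the weight of that
    node. Two integrations by parts turn the quadrature error into the integral
    of K f'' ([Q01_peano]). The mean of K is (4 - 3 sqrt 2) / 96, so P is the
    product of the means of K and f'' ([P01_peano]), and Q - P is the covariance
    of K and f'' on [0, 1]. By the Cauchy-Schwarz inequality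
    ([covariance01_le]) it is at most the product of their standard deviations;
    that of f'' is sigma, and the variance of K is
    47 / 23040 - sqrt 2 / 768 ([variance01_peano_kernel]). Equality holds when
    f'' differs from K by a constant; [extremal] is such a function, explicit in
    terms of t - 1 / 2 and its absolute value, and it forces c to be at least
    the constant of the theorem.

    The analytic content lies in the integration by parts, as f' is only
    absolutely continuous. One needs that such a function g is almost everywhere
    differentiable and is the integral of its derivative ([lac_FTC]). By the
    Jordan decomposition g is a difference of two nondecreasing absolutely
    continuous functions; the point is that the total variation is again
    absolutely continuous ([family_tv_le]). The Stieltjes measure of a
    nondecreasing absolutely continuous function vanishes on Lebesgue-null sets
    ([lebesgue_stieltjes_null]), so the Radon-Nikodym theorem provides a density
    ([lac_monotone_density]), which the Lebesgue differentiation theorem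
    identifies with the derivative. The integration by parts is then this
    theorem for the absolutely continuous function K f' - K' f, on each half of
    [0, 1] ([quadratic_by_parts]). *)

Set Implicit Arguments.
Unset Strict Implicit.
Unset Printing Implicit Defensive.

Import Order.TTheory GRing.Theory Num.Theory.
Import numFieldNormedType.Exports.

Local Open Scope classical_set_scope.
Local Open Scope ring_scope.

(** * Absolute continuity on finite families of intervals *)

Section interval_families.
Context {R : realType}.
Implicit Types (a b x y : R) (g u v : R -> R) (p q : R * R) (L : seq (R * R)).

Definition subinterval a b p := [&& a <= p.1, p.1 < p.2 & p.2 <= b].

Definition nonoverlapping p q := (p.2 <= q.1) || (q.2 <= p.1).

Definition interval_family a b L :=
  all (subinterval a b) L && pairwise nonoverlapping L.

Definition family_length L := \sum_(p <- L) (p.2 - p.1).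

Definition family_variation g L := \sum_(p <- L) `|g p.2 - g p.1|.

(** Families are lists of nondegenerate intervals: unlike families indexed by
    ordinals, lists can be concatenated, filtered and refined, which is what
    the arguments on total variation and on open sets need. *)
Definition list_absolutely_continuous a b g :=
  forall e : R, 0 < e -> exists2 d : R, 0 < d &
    forall L, interval_family a b L -> family_length L < d ->
      family_variation g L < e.

Lemma absolutely_continuous_on_list a b g :
  absolutely_continuous_on a b g -> list_absolutely_continuous a b g.
Proof.
move=> acg e /acg[d d0 acd]; exists d => // L /andP[/allP Lab Ldis] Ld.
have Lnth (i : 'I_(size L)) : subinterval a b (nth (a, a) L i).
  by apply: Lab; exact: mem_nth.
have disj (i j : 'I_(size L)) : (i < j)%N ->
    nonoverlapping (nth (a, a) L i) (nth (a, a) L j).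
  move: Ldis => /(pairwiseP (a, a)) Ldis ij.
  by apply: Ldis => //; rewrite unfold_in/= ltn_ord.
rewrite /family_variation (big_nth (a, a)) big_mkord.
apply: (acd _ (fun i => (nth (a, a) L i).1) (fun i => (nth (a, a) L i).2)).
- by move=> i; have /and3P[? /ltW ? ?] := Lnth i.
- apply/trivIsetP => i j _ _ ij; apply/seteqP; split => // z [] /=.
  rewrite !in_itv/= => /andP[z1 z2] /andP[z3 z4].
  have /orP[] : (i < j)%N || (j < i)%N by rewrite -neq_ltn.
  + by move=> /disj /orP[] h; lra.
  + by move=> /disj /orP[] h; lra.
- by move: Ld; rewrite /family_length (big_nth (a, a)) big_mkord.
Qed.

Lemma lac_uniformly_continuous a b g : list_absolutely_continuous a b g ->
  forall e : R, 0 < e -> exists2 d : R, 0 < d &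
    forall x y, a <= x -> x <= b -> a <= y -> y <= b -> `|y - x| < d ->
      `|g y - g x| < e.
Proof.
move=> acg e e0; have [d d0 acd] := acg e e0; exists d => // x y.
wlog xy : x y / x < y.
  move=> h ax xb ay yb; have [xy|yx|->] := ltgtP x y; first exact: h.
    by rewrite distrC (distrC (g y)); exact: h.
  by rewrite !subrr normr0.
move=> ax xb ay yb dxy.
have := acd [:: (x, y)]; rewrite /family_length /family_variation !big_seq1/=.
apply; first by rewrite /interval_family/= /subinterval/= ax xy yb.
by rewrite (le_lt_trans (ler_norm _)).
Qed.

Lemma lacS a b c d g : a <= c -> d <= b ->
  list_absolutely_continuous a b g -> list_absolutely_continuous c d g.
Proof.
move=> ac db acg e /acg[r r0 acr]; exists r => // L /andP[Lcd Ldis] Lr.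
apply: acr => //; rewrite /interval_family Ldis andbT.
apply: sub_all Lcd => p /and3P[cp pp pd].
by rewrite /subinterval (le_trans ac cp) pp (le_trans pd db).
Qed.

Lemma eq_lac a b u v : {in `[a, b], u =1 v} ->
  list_absolutely_continuous a b u -> list_absolutely_continuous a b v.
Proof.
move=> uv acu e /acu[r r0 acr]; exists r => // L Lab Lr.
suff <- : family_variation u L = family_variation v L by exact: acr.
have /andP[/allP Lab' _] := Lab.
apply: eq_big_seq => p /Lab' /and3P[ap pp pb]; rewrite !uv//.
  by rewrite in_itv/= ap (le_trans (ltW pp) pb).
by rewrite in_itv/= pb (le_trans ap (ltW pp)).
Qed.

(** The common source of the closure properties: a function whose increments
    are linearly controlled by those of absolutely continuous functions is
    absolutely continuous. *)
Lemma lac_le a b g u v (M N : R) :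
  (forall x y, a <= x -> x < y -> y <= b ->
    `|g y - g x| <= M * `|u y - u x| + N * `|v y - v x|) ->
  list_absolutely_continuous a b u -> list_absolutely_continuous a b v ->
  list_absolutely_continuous a b g.
Proof.
move=> guv acu acv e e0.
pose K := `|M| + `|N| + 1.
have K0 : 0 < K by rewrite /K ltr_wpDl// addr_ge0.
have eK : 0 < e / K by rewrite divr_gt0.
have [d d0 acd] := acu _ eK; have [r r0 acr] := acv _ eK.
exists (Num.min d r); first by rewrite lt_min d0 r0.
move=> L Lab; rewrite lt_min => /andP[/(acd _ Lab) ud /(acr _ Lab) vr].
have gle : family_variation g L <=
    M * family_variation u L + N * family_variation v L.
  rewrite /family_variation !mulr_sumr -big_split/=.
  move/andP: Lab => [/allP Lab _].
  rewrite !big_seq; apply: ler_sum => p /Lab /and3P[ap pp pb].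
  exact: guv.
have fv0 w : 0 <= family_variation w L by apply: sumr_ge0.
apply: (le_lt_trans gle).
have h (m w : R) : 0 <= w -> w < e / K -> m * w <= `|m| * (e / K).
  move=> w0 we; apply: (@le_trans _ _ (`|m| * w)).
    by rewrite ler_wpM2r// ler_norm.
  by rewrite ler_wpM2l// ltW.
apply: (@le_lt_trans _ _ (`|M| * (e / K) + `|N| * (e / K))).
  by apply: lerD; exact: h.
rewrite -mulrDl mulrA ltr_pdivrMr// mulrC ltr_pM2l//.
by rewrite /K ltrDl.
Qed.

Lemma lac_id a b : list_absolutely_continuous a b id.
Proof.
move=> e e0; exists e => // L /andP[/allP Lab _].
suff -> : family_variation id L = family_length L by [].
apply: eq_big_seq => p /Lab /and3P[_ pp _].
by rewrite ger0_norm// subr_ge0 ltW.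
Qed.

Lemma lac_lipschitz a b g (M : R) :
  (forall x y, a <= x -> x < y -> y <= b -> `|g y - g x| <= M * `|y - x|) ->
  list_absolutely_continuous a b g.
Proof.
move=> gM; apply: (@lac_le a b g id id M 0); [|exact: lac_id..].
by move=> x y ax xy yb; rewrite mul0r addr0; exact: gM.
Qed.

Lemma lacB a b u v : list_absolutely_continuous a b u ->
  list_absolutely_continuous a b v -> list_absolutely_continuous a b (u \- v).
Proof.
apply: (@lac_le _ _ _ _ _ 1 1) => x y _ _ _; rewrite !mul1r/=.
have -> : (u \- v) y - (u \- v) x = (u y - u x) - (v y - v x).
  by rewrite /=; ring.
exact: ler_normB.
Qed.

End interval_families.

(** * Total variation of an absolutely continuous function *)

Section total_variation_ac.
Context {R : realType}.
Implicit Types (a b x y : R) (g u v : R -> R) (p q : R * R) (L : seq (R * R)).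

(** The intervals cut out of [x, last x s] by the points of s. *)
Definition consecutive x (s : seq R) := zip (x :: s) s.

Lemma consecutive_family x y s : itv_partition x y s ->
  interval_family x y (consecutive x s).
Proof.
elim: s x => [//|z s ih] x.
move=> [/= /andP[xz zs] lzs].
have zys : itv_partition z y s by split.
have /andP[fam dis] := ih _ zys.
have zy := itv_partition_le zys.
rewrite /interval_family /consecutive/= -/(consecutive z s).
rewrite {1}/subinterval/= lexx xz zy/= dis andbT; apply/andP; split.
  apply: sub_all fam => p /and3P[zp pp py].
  by rewrite /subinterval (le_trans (ltW xz) zp) pp py.
by apply: sub_all fam => p /and3P[zp pp py]; rewrite /nonoverlapping/= zp.
Qed.

Lemma consecutive_length x y s : itv_partition x y s ->
  family_length (consecutive x s) = y - x.
Proof.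
elim: s x => [|z s ih] x.
  move=> [_ /= /eqP ->]; rewrite /family_length/consecutive/=.
  by rewrite big_nil subrr.
move=> [/= /andP[xz zs] lzs].
rewrite /family_length /consecutive/= big_cons/= -/(consecutive z s).
by rewrite -/(family_length _) ih//; ring.
Qed.

Lemma consecutive_variation x y s g : itv_partition x y s ->
  family_variation g (consecutive x s) = variation x y g s.
Proof.
elim: s x => [|z s ih] x.
  by move=> _; rewrite /family_variation/consecutive/= /variation !big_nil.
move=> [/= /andP[xz zs] lzs].
rewrite /family_variation /consecutive/= big_cons/= -/(consecutive z s).
rewrite -/(family_variation _ _) ih// /variation/= big_nat_recl//=.
Qed.

(** Total variation obeys the same bound as the increments: refining an
    interval of the family keeps the family admissible and its length
    unchanged, and the total variation is the supremum over refinements. The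
    intervals are refined one at a time: those of L1 still carry their total
    variation, those of L2 only their increment. *)
Lemma family_tv_le a b g (e d : R) :
  (forall L, interval_family a b L -> family_length L < d ->
    family_variation g L < e) ->
  forall L1 L2, interval_family a b (L1 ++ L2) ->
    family_length (L1 ++ L2) < d ->
  (\sum_(p <- L1) total_variation p.1 p.2 g + (family_variation g L2)%:E <= e%:E)%E.
Proof.
move=> acd; elim => [|p L1 ih] L2 /=.
  by move=> L2ab L2d; rewrite big_nil add0e lee_fin ltW// acd.
rewrite /interval_family/= all_cat pairwise_cat.
move=> /andP[/and3P[pab L1ab L2ab] /and4P[pL L12 L1p L2p]].
rewrite {1}/family_length [X in X < _]big_cons/= -/(family_length (L1 ++ L2)) => pd.
have /and3P[ap pp pb] := pab.
have sub0 : (0 <= \sum_(q <- L1) total_variation q.1 q.2 g)%E.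
  rewrite big_seq; apply: sume_ge0 => q qL1.
  by move/allP: L1ab => /(_ _ qL1) /and3P[_ qq _]; exact/total_variation_ge0/ltW.
have Sfin : (\sum_(q <- L1) total_variation q.1 q.2 g +
             (family_variation g L2)%:E)%E \is a fin_num.
  rewrite ge0_fin_numE; last by rewrite adde_ge0// lee_fin sumr_ge0.
  rewrite (@le_lt_trans _ _ e%:E) ?ltry// ih//.
    by rewrite /interval_family all_cat pairwise_cat L1ab L2ab L12 L1p L2p.
  by move: pd; have := pp; lra.
rewrite big_cons -addeA -leeBrDr//.
apply: ge_ereal_sup => _ [_ [s ps <-] <-].
rewrite leeBrDr// addeCA -(consecutive_variation g ps).
rewrite -EFinD -[X in (_ + X%:E)%E]big_cat/=; apply: ih.
  have /andP[/allP sp sdis] := consecutive_family ps.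
  have sub q : q \in consecutive p.1 s -> subinterval a b q.
    move=> /sp /and3P[p1 qq p2].
    by rewrite /subinterval (le_trans ap p1) qq (le_trans p2 pb).
  have nov q r : q \in consecutive p.1 s -> r \in L1 ++ L2 ->
      nonoverlapping q r.
    move=> /sp /and3P[p1 qq p2] rL; move/allP: pL => /(_ _ rL).
    rewrite /nonoverlapping => /orP[h|h].
      by rewrite (le_trans p2 h).
    by rewrite (le_trans h p1) orbT.
  have symn (q r : R * R) : nonoverlapping q r = nonoverlapping r q.
    by rewrite /nonoverlapping orbC.
  rewrite /interval_family !all_cat L1ab L2ab andbT/= !pairwise_cat.
  rewrite L1p L2p sdis !andbT !andTb; apply/and3P; split.
  - exact/allP.
  - apply/allrelP => q r qL; rewrite mem_cat => /orP[rs|rL2].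
      by rewrite symn; apply: nov => //; rewrite mem_cat qL.
    by move/allrelP: L12; apply.
  - by apply/allrelP => q r qs rL2; apply: nov => //; rewrite mem_cat rL2 orbT.
rewrite /family_length !big_cat/= -/(family_length _) -/(family_length _).
rewrite -/(family_length _) (consecutive_length ps).
by move: pd; rewrite /family_length big_cat/= addrCA.
Qed.

(** The variation is at most 1 on each interval shorter than the d given by
    absolute continuity for e := 1, and finitely many steps of length d / 2
    exhaust the interval. *)
Lemma lac_tv_fin a b g : a <= b -> list_absolutely_continuous a b g ->
  total_variation a b g \is a fin_num.
Proof.
move=> ab acg; have [d d0 acd] := acg 1 ltr01.
have d20 : 0 < d / 2 by rewrite divr_gt0.
suff H n x : a <= x -> x <= b -> x <= a + n%:R * (d / 2) ->
    total_variation a x g \is a fin_num.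
  apply: (H (Num.bound ((b - a) / (d / 2)))) => //.
  rewrite -lerBlDl -ler_pdivrMr// ltW// archi_boundP//.
  by rewrite divr_ge0 ?subr_ge0 // ltW.
elim: n x => [|n ih] x ax xb.
  rewrite mul0r addr0 => xa; have -> : x = a by apply/le_anti; rewrite ax xa.
  by rewrite total_variationxx.
rewrite -natr1 mulrDl mul1r => xn; pose m := Num.max a (x - d / 2).
have am : a <= m by rewrite /m le_max lexx.
have mx : m <= x by rewrite /m ge_max ax/= gerBl ltW.
rewrite (total_variationD _ am mx) fin_numD ih//=; last 2 first.
  exact: le_trans xb.
  rewrite /m ge_max lerDl mulr_ge0//; last exact: ltW.
  by lra.
rewrite ge0_fin_numE ?total_variation_ge0//.
have [->|xm] := eqVneq m x; first by rewrite total_variationxx ltry.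
have := @family_tv_le _ _ _ _ _ acd [:: (m, x)] [::].
rewrite big_seq1 /family_variation big_nil adde0/= => h.
apply: (@le_lt_trans _ _ 1%E); last exact: ltry.
apply: h; first by rewrite /interval_family/= /subinterval/= am xb lt_neqAle xm mx.
rewrite /family_length big_seq1/=.
have : x - d / 2 <= m by rewrite /m le_max lexx orbT.
by lra.
Qed.

Lemma lac_bounded a b g : list_absolutely_continuous a b g ->
  exists2 M : R, 0 <= M & forall x, a <= x -> x <= b -> `|g x| <= M.
Proof.
move=> acg; have [ab|ba] := leP a b; last first.
  by exists 0 => // x ax xb; have := le_trans ax xb; rewrite leNgt ba.
have tvf := lac_tv_fin ab acg.
exists (`|g a| + fine (total_variation a b g)).
  by rewrite addr_ge0// fine_ge0// total_variation_ge0.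
move=> x ax xb; rewrite -[g x](subrK (g a)) addrC.
rewrite (le_trans (ler_normD _ _))// lerD2l -lee_fin fineK//.
rewrite (total_variationD g ax xb) (le_trans (total_variation_ge g ax))//.
by rewrite leeDl// total_variation_ge0.
Qed.

Lemma lacM a b u v : list_absolutely_continuous a b u ->
  list_absolutely_continuous a b v -> list_absolutely_continuous a b (u \* v).
Proof.
move=> acu acv.
have [M M0 uM] := lac_bounded acu; have [N N0 vN] := lac_bounded acv.
apply: (@lac_le _ a b _ u v N M) => // x y ax xy yb; rewrite /=.
have -> : (u \* v) y - (u \* v) x = v y * (u y - u x) + u x * (v y - v x).
  by rewrite /=; ring.
rewrite (le_trans (ler_normD _ _))// !normrM; apply: lerD.
  by rewrite ler_wpM2r// vN// (le_trans ax)// ltW.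
by rewrite ler_wpM2r// uM// (le_trans (ltW xy)).
Qed.

(** Jordan decomposition g = T - (T - g) with T the variation from a to the
    current point; T inherits absolute continuity by [family_tv_le]. *)
Lemma lac_monotone_decomposition a b g : a <= b ->
  list_absolutely_continuous a b g ->
  exists u v, [/\ {in `[a, b] &, nondecreasing_fun u},
    {in `[a, b] &, nondecreasing_fun v},
    list_absolutely_continuous a b u, list_absolutely_continuous a b v &
    forall x, g x = u x - v x].
Proof.
move=> ab acg; pose T x := fine (total_variation a x g).
have tvf x y : a <= x -> x <= y -> y <= b ->
    total_variation x y g \is a fin_num.
  by move=> ax xy yb; apply: lac_tv_fin => //; apply: (lacS ax yb acg).
have TB x y : a <= x -> x <= y -> y <= b ->
    T y - T x = fine (total_variation x y g).
  move=> ax xy yb; rewrite /T (total_variationD _ ax xy) fineD ?tvf//.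
    by rewrite addrAC subrr add0r.
  exact: le_trans yb.
have TBge x y : a <= x -> x <= y -> y <= b -> `|g y - g x| <= T y - T x.
  move=> ax xy yb; rewrite TB// -lee_fin fineK ?tvf//.
  exact: total_variation_ge.
have acT : list_absolutely_continuous a b T.
  move=> e e0; have e20 : 0 < e / 2 by rewrite divr_gt0.
  have [d d0 acd] := acg _ e20; exists d => // L Lab Ld.
  have /andP[/allP Lab' _] := Lab.
  have := @family_tv_le _ _ _ _ _ acd L [::].
  rewrite cats0 => /(_ Lab Ld).
  rewrite /family_variation big_nil adde0 => h.
  apply: (@le_lt_trans _ _ (e / 2)); last by rewrite ltr_pdivrMr// ltr_pMr// ltr1n.
  rewrite -lee_fin (le_trans _ h)// -sumEFin !big_seq.
  apply: lee_sum => p /Lab' /and3P[ap pp pb].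
  have pple := ltW pp; rewrite TB// ger0_norm; last first.
    by rewrite fine_ge0// total_variation_ge0.
  by rewrite fineK// tvf.
exists T, (T \- g); split => //.
- move=> x y; rewrite !in_itv/= => /andP[ax xb] /andP[ay yb] xy.
  by rewrite -subr_ge0 (le_trans _ (TBge _ _ ax xy yb)).
- move=> x y; rewrite !in_itv/= => /andP[ax xb] /andP[ay yb] xy.
  have := TBge _ _ ax xy yb; have := ler_norm (g y - g x); lra.
- exact: lacB.
- by move=> x /=; ring.
Qed.

End total_variation_ac.

(** * Absolute continuity of Stieltjes measures *)

Section interval_hull.
Context {R : realType}.
Implicit Types (a b x y : R) (V W : set R).

Lemma interval_hull a b V : is_interval V -> V !=set0 -> V `<=` `]a, b] ->
  [/\ a <= inf V, inf V <= sup V, sup V <= b,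
    V `<=` `[inf V, sup V] & `]inf V, sup V[ `<=` V].
Proof.
move=> iV V0 Vab.
have lV : has_lbound V by exists a => z /Vab /=; rewrite in_itv/= => /andP[/ltW].
have uV : has_ubound V by exists b => z /Vab /=; rewrite in_itv/= => /andP[].
have hull : V `<=` `[inf V, sup V].
  by move=> z Vz; rewrite /= in_itv/= ge_inf// ub_le_sup.
have [z Vz] := V0; have := hull _ Vz; rewrite /= in_itv/= => /andP[iz zs].
split => //.
- by apply: lb_le_inf => // w /Vab /=; rewrite in_itv/= => /andP[/ltW].
- exact: le_trans zs.
- by apply: ge_sup => // w /Vab /=; rewrite in_itv/= => /andP[].
- apply: subset_trans (@interior_subset _ V).
  by rewrite interval_bounded_interior// => w /=; rewrite in_itv.
Qed.

Lemma disjoint_nonoverlapping (p q : R * R) : p.1 < p.2 -> q.1 < q.2 ->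
  `]p.1, p.2[ `&` `]q.1, q.2[ = set0 -> nonoverlapping p q.
Proof.
move=> pp qq pq0; apply: contraT; rewrite /nonoverlapping negb_or -!ltNge.
move=> /andP[qp pq].
pose x := Num.max p.1 q.1; pose y := Num.min p.2 q.2.
have xy : x < y by rewrite /x /y gt_max !lt_min pp qp pq qq.
have [x1 x2] : p.1 <= x /\ q.1 <= x by rewrite /x !le_max !lexx orbT.
have [y1 y2] : y <= p.2 /\ y <= q.2 by rewrite /y !ge_min !lexx orbT.
suff : (set0 : set R) ((x + y) / 2) by [].
by rewrite -pq0; split; rewrite /= in_itv/=; apply/andP; split; lra.
Qed.

End interval_hull.

Section stieltjes.
Context {R : realType}.
Variable c : cumulative R R.
Implicit Types (a b x y : R) (V W N : set R).

Local Notation lambda := (@lebesgue_measure R).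
Local Notation mu := (lebesgue_stieltjes_measure c).

Lemma lebesgue_stieltjes_itvoc x y : x <= y -> mu `]x, y] = (c y - c x)%:E.
Proof.
move=> xy; rewrite /lebesgue_stieltjes_measure/= /measure_extension/=.
rewrite measurable_mu_extE; first exact: wlength_itv_bnd.
exact: is_ocitv.
Qed.

Hypothesis cc : continuous c.

(** A closed interval is contained in left-open ones with a slightly smaller
    left end point, and c is left continuous. *)
Lemma lebesgue_stieltjes_itvcc_le x y V : measurable V -> x <= y ->
  V `<=` `[x, y] -> (mu V <= (c y - c x)%:E)%E.
Proof.
move=> mV xy Vxy; apply/lee_addgt0Pr => e e0.
have /cvgrPdist_lt/(_ _ e0) [r /= r0 cr] := @cc x.
have xr : x - r / 2 <= x by rewrite gerBl ltW// divr_gt0.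
have cxr : c (x - r / 2) <= c x by exact: cumulative_is_nondecreasing.
apply: (@le_trans _ _ (mu `]x - r / 2, y])).
  apply: le_measure; rewrite ?inE//.
  move=> z /Vxy; rewrite /= !in_itv/= => /andP[xz ->]; rewrite andbT.
  by rewrite (lt_le_trans _ xz)// gtrBl divr_gt0.
rewrite lebesgue_stieltjes_itvoc ?(le_trans xr)// -EFinD lee_fin.
have : `|c x - c (x - r / 2)| < e.
  apply: cr; rewrite /ball_/= opprB addrC subrK gtr0_norm ?divr_gt0//.
  by rewrite ltr_pdivrMr// ltr_pMr// ltr1n.
by rewrite ger0_norm ?subr_ge0//; lra.
Qed.

(** A Lebesgue-null set lies in an open set U of measure less than d. The
    components of U within ]a, b] are nonoverlapping intervals of total length
    less than d, so absolute continuity bounds the sum of the increments of c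
    over any finitely many of them by e, hence the Stieltjes measure of U
    within ]a, b] too. *)
Lemma lebesgue_stieltjes_null a b N :
  list_absolutely_continuous a b c -> measurable N -> lambda N = 0%E ->
  mu (N `&` `]a, b]) = 0%E.
Proof.
move=> acc mN N0; apply/eqP; rewrite eq_le measure_ge0 andbT.
apply/lee_addgt0Pr => e e0; rewrite add0e.
have [d d0 acd] := acc _ e0.
have Noo : (lambda N < +oo)%E by rewrite N0 ltry.
have [U [oU NU UNd]] := lebesgue_regularity_outer mN Noo d0.
have mU : measurable U by exact: open_measurable.
have Ud : (lambda U < d%:E)%E.
  apply: (le_lt_trans _ UNd); rewrite -[leRHS]adde0 -[in leRHS]N0.
  rewrite -{1}(setDUK NU) setUC; apply: measureU2 => //; exact: measurableD.
pose I := open_disjoint_itv oU; pose V i := I i `&` `]a, b].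
have mI i : measurable (I i).
  by apply: open_measurable; exact: open_disjoint_itv_open.
have mV i : measurable (V i) by exact: measurableI.
have iV i : is_interval (V i).
  move=> x y [Ix xab] [Iy yab] z xyz; split.
    exact: (open_disjoint_itv_is_interval Ix Iy).
  move: xab yab xyz; rewrite /= !in_itv/= => /andP[ax _] /andP[_ yb] /andP[xz zy].
  by rewrite (lt_le_trans ax xz) (le_trans zy yb).
have Vab i : V i `<=` `]a, b] by move=> x [].
have NV : N `&` `]a, b] `<=` \bigcup_i V i.
  move=> x [/NU]; rewrite {1}(open_disjoint_itv_bigcup oU) => -[i _ Ii] xab.
  by exists i.
apply: (@le_trans _ _ (\sum_(i <oo) mu (V i))%E).
  apply: measure_sigma_subadditive => //; last exact: measurableI.
apply: lime_le; first by apply: is_cvg_nneseries.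
apply: nearW => n.
pose P i := (V i != set0) && (inf (V i) < sup (V i)).
pose L := [seq (inf (V i), sup (V i)) | i <- index_iota 0 n & P i].
have hullP i : P i -> [/\ a <= inf (V i), inf (V i) <= sup (V i), sup (V i) <= b,
    V i `<=` `[inf (V i), sup (V i)] & `]inf (V i), sup (V i)[ `<=` V i].
  by move=> /andP[/set0P V0 _]; exact: interval_hull.
have Lab : interval_family a b L.
  apply/andP; split.
    apply/allP => _ /mapP[i + ->]; rewrite mem_filter => /andP[Pi _].
    have [ai _ sb _ _] := hullP _ Pi; have /andP[_ is_] := Pi.
    by rewrite /subinterval/= ai is_ sb.
  rewrite pairwise_map.
  have : pairwise [rel x y : nat | x != y] [seq i <- index_iota 0 n | P i].
    by rewrite -uniq_pairwise filter_uniq// iota_uniq.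
  apply: (@sub_in_pairwise _ P); last exact: filter_all.
  move=> i j Pi Pj /= ij.
  have /andP[_ ii] := Pi; have /andP[_ jj] := Pj.
  apply: disjoint_nonoverlapping => //=.
  have [_ _ _ _ Vi] := hullP _ Pi; have [_ _ _ _ Vj] := hullP _ Pj.
  have := @open_disjoint_itv_trivIset R U oU.
  move=> /trivIsetP /(_ i j Logic.I Logic.I ij) IJ.
  by rewrite -subset0 -IJ => x [/Vi[? _] /Vj[? _]]; split.
have Ld : family_length L < d.
  rewrite -lte_fin; apply: le_lt_trans Ud.
  rewrite /family_length big_map big_filter/= -sumEFin.
  apply: (@le_trans _ _ (\sum_(0 <= i < n) lambda (I i))%E).
    rewrite [leLHS]big_mkcond/=; apply: lee_sum => i _; case: ifPn => // Pi.
    have [_ _ _ _ Vi] := hullP _ Pi; have /andP[_ ii] := Pi.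
    have <- : lambda `]inf (V i), sup (V i)[ = (sup (V i) - inf (V i))%:E.
      by rewrite lebesgue_measure_itv/= lte_fin ii EFinB.
    apply: le_measure; rewrite ?inE; [exact: measurable_itv|exact: mI|].
    by move=> x /Vi[].
  have -> : lambda U = (\sum_(i <oo) lambda (I i))%E.
    rewrite [in LHS](open_disjoint_itv_bigcup oU) measure_bigcup//.
      by apply: eq_eseriesl => i; rewrite in_setT.
      by move=> i _; exact: mI.
    exact: open_disjoint_itv_trivIset.
  exact: nneseries_lim_ge.
apply: (@le_trans _ _ (family_variation c L)%:E); last by rewrite lee_fin ltW// acd.
rewrite /family_variation big_map big_filter/= -sumEFin.
rewrite [leRHS]big_mkcond/=; apply: lee_sum => i _; case: ifPn => Pi.
  have [_ ii _ Vi _] := hullP _ Pi.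
  by rewrite (le_trans (lebesgue_stieltjes_itvcc_le _ ii _))// lee_fin ler_norm.
have [->|V0] := eqVneq (V i) set0; first by rewrite measure0.
have [_ ii _ Vi _] := interval_hull (iV i) ((set0P _).1 V0) (Vab i).
rewrite (le_trans (lebesgue_stieltjes_itvcc_le _ ii _))// lee_fin.
move: Pi; rewrite /P V0/= -leNgt => si.
by rewrite subr_le0 cumulative_is_nondecreasing.
Qed.

End stieltjes.

Section monotone_density.
Context {R : realType}.
Implicit Types (a b x y : R).

Local Notation lambda := (@lebesgue_measure R).

(** The Stieltjes measure of g, extended by constants outside [a, b] and
    restricted to ]a, b], is finite and absolutely continuous with respect to
    the Lebesgue measure; its Radon-Nikodym density is the integrand. *)
Lemma lac_monotone_density a b (g : R -> R) : a < b ->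
  {in `[a, b] &, nondecreasing_fun g} -> list_absolutely_continuous a b g ->
  exists2 h : R -> R, lambda.-integrable setT (EFin \o h) &
    forall x, a <= x -> x <= b -> g x - g a = \int[lambda]_(t in `[a, x]) h t.
Proof.
move=> ab ndg acg.
(* The projection of the real line onto [a, b]. *)
pose cl x := Num.max a (Num.min b x).
have clab x : a <= cl x <= b by rewrite /cl le_max lexx/= ge_max ltW//= ge_min lexx.
have clE x : a <= x -> x <= b -> cl x = x.
  by move=> ax xb; rewrite /cl min_r// max_r.
have ndcl x y : x <= y -> cl x <= cl y.
  move=> xy; rewrite /cl ge_max le_max lexx/= le_max le_min.
  by rewrite !ge_min lexx/= xy !orbT.
have clL x y : `|cl x - cl y| <= `|x - y|.
  wlog xy : x y / x <= y.
    by move=> h; have [xy|/ltW yx] := leP x y; [|rewrite distrC (distrC x)]; exact: h.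
  rewrite distrC (distrC x) !ger0_norm ?subr_ge0 ?ndcl// /cl.
  by rewrite /Num.max /Num.min; do ! case: ifPn => //; rewrite -?leNgt => *; lra.
pose F x := g (cl x).
have ndF : nondecreasing F.
  by move=> x y xy; apply: ndg; rewrite ?in_itv/= ?clab//; exact: ndcl.
have cF : continuous F.
  move=> x; apply/cvgrPdist_lt => e e0.
  have [d d0 gd] := lac_uniformly_continuous acg e0.
  near=> y.
  have xyd : `|x - y| < d by near: y; exact: (@cvgr_dist_lt _ R^o).
  rewrite distrC.
  have /andP[xa xb] := clab x; have /andP[ya yb] := clab y.
  apply: gd => //; rewrite distrC (le_lt_trans (clL _ _))// distrC.
pose c : cumulative R R := HB.pack F
  (isCumulative.Build R _ R F ndF (right_continuousW cF)).
have acc : list_absolutely_continuous a b c.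
  apply: eq_lac acg => x; rewrite in_itv/= => /andP[ax xb].
  by rewrite /F clE.
have mD : measurable (`]a, b] : set (measurableTypeR R)) by exact: measurable_itv.
have Doo : (lebesgue_stieltjes_measure c `]a, b] < +oo)%E.
  by rewrite lebesgue_stieltjes_itvoc ?ltW// ltry.
pose nu : {finite_measure set (measurableTypeR R) -> \bar R} := mfrestr mD Doo.
have numu : nu `<< lambda.
  apply/null_content_dominatesP => N mN N0; rewrite /nu/= /mfrestr /mrestr.
  exact: lebesgue_stieltjes_null.
pose h := Radon_Nikodym_SigmaFinite.f nu lambda.
have hfin x : h x \is a fin_num by exact: Radon_Nikodym_SigmaFinite.f_fin_num.
have hE : EFin \o (fine \o h) = h by apply/funext => x /=; rewrite fineK.
have hint : lambda.-integrable setT h by exact: Radon_Nikodym_SigmaFinite.f_integrable.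
exists (fine \o h); first by rewrite hE.
move=> x ax xb; apply: EFin_inj.
rewrite -Rintegral_itv_obnd_cbnd; last first.
  by rewrite hE; apply: integrableS hint.
rewrite /Rintegral -[X in _ = (fine (integral _ _ X))%:E]/(EFin \o (fine \o h)).
rewrite hE -Radon_Nikodym_SigmaFinite.f_integral//.
rewrite /nu/= /mfrestr /mrestr setIidl; last first.
  by move=> z; rewrite /= !in_itv/= => /andP[-> zx]; rewrite (le_trans zx).
by rewrite lebesgue_stieltjes_itvoc//= /F !clE// ?ltW.
Unshelve. all: by end_near. Qed.

End monotone_density.

(** * The fundamental theorem of calculus for absolutely continuous functions *)

Section lac_FTC.
Context {R : realType}.
Implicit Types (a b x y : R) (f g h : R -> R).

Local Notation lambda := (@lebesgue_measure R).

(** The density comes from the two monotone parts of g; that it is almost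
    everywhere the derivative is the Lebesgue differentiation theorem. *)
Lemma lac_FTC a b g : a < b -> list_absolutely_continuous a b g ->
  exists h, [/\ lambda.-integrable setT (EFin \o h),
    (forall x, a <= x -> x <= b -> g x - g a = \int[lambda]_(t in `[a, x]) h t) &
    {ae lambda, forall x, x \in `]a, b[ -> is_derive x 1 g (h x)}].
Proof.
move=> ab acg.
have [u [v [ndu ndv acu acv guv]]] := lac_monotone_decomposition (ltW ab) acg.
have [hu hui hu_] := lac_monotone_density ab ndu acu.
have [hv hvi hv_] := lac_monotone_density ab ndv acv.
pose h x := hu x - hv x.
have hi : lambda.-integrable setT (EFin \o h).
  by rewrite (_ : _ \o h = (EFin \o hu) \- (EFin \o hv))%E//; exact: integrableB.
have hiS (D : set R) : measurable D -> lambda.-integrable D (EFin \o h).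
  by move=> mD; exact: integrableS hi.
have gE x : a <= x -> x <= b -> g x - g a = \int[lambda]_(t in `[a, x]) h t.
  move=> ax xb; rewrite RintegralB//; last 2 first.
    exact: integrableS hui.
    exact: integrableS hvi.
  by rewrite -hu_// -hv_// !guv; ring.
exists h; split => //.
have loch : locally_integrable setT h.
  by apply: open_integrable_locally => //; exact: openT.
have := @FTC1 R h (BLeft a) (fun y => hiS _ (measurable_itv _)) loch.
apply: filterS; first exact: (ae_filter_ringOfSetsType lambda).
move=> x /= Fx; rewrite in_itv/= => /andP[ax xb].
have [] := Fx; first by rewrite lte_fin.
set F := fun y => _ => dF F'x.
have isF : is_derive x 1 (fun y => g a + F y) (h x).
  rewrite -[h x]add0r; apply: is_deriveD.
  by apply: DeriveDef => //; rewrite -derive1E.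
apply: near_eq_is_derive isF.
near=> y.
have /andP[ay yb] : a < y < b.
  near: y; have := @near_in_itvoo R a b x; rewrite !in_itv/= ax xb => /(_ isT).
  by apply: filterS => y; rewrite in_itv.
by rewrite /F -(gE _ (ltW ay) (ltW yb)); ring.
Unshelve. all: by end_near. Qed.

End lac_FTC.

(** * Derivatives relative to an interval *)

Section derivatives_on.
Context {R : realType}.
Implicit Types (a b x y : R) (f g h : R -> R) (A : set R).

(** Every point of a nondegenerate closed interval is a limit point of it, end
    points included; this makes relative derivatives unique. *)
Lemma within_itv_dnbhs_proper a b x : a < b -> a <= x <= b ->
  ProperFilter (within `[a, b] x^').
Proof.
move=> ab /andP[ax xb].
apply: Build_ProperFilter; rewrite /within/= => -[e /= e0 xe].
have key y : y != x -> `|x - y| < e -> a <= y -> y <= b -> False.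
  by move=> yx xye ay yb; apply: (xe y) => //=; rewrite in_itv/= ay.
have [xb'|bx] := ltP x b.
  pose y := Num.min (x + e / 2) b.
  have xy : x < y by rewrite /y lt_min xb' andbT ltrDl divr_gt0.
  have [y1 yb] : y <= x + e / 2 /\ y <= b by rewrite /y !ge_min !lexx orbT.
  apply: (key y) => //; rewrite ?gt_eqF//; last by lra.
  by rewrite distrC gtr0_norm ?subr_gt0//; lra.
pose y := Num.max (x - e / 2) a.
have xy : y < x by rewrite /y gt_max gtrBl divr_gt0//=; lra.
have [y1 ay] : x - e / 2 <= y /\ a <= y by rewrite /y !le_max !lexx orbT.
apply: (key y) => //; rewrite ?lt_eqF//; last by lra.
by rewrite gtr0_norm ?subr_gt0//; lra.
Qed.

Lemma is_derive_quotients_on A f x l : is_derive x 1 f l ->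
  quotients_on A f x --> l.
Proof.
move=> /is_derive1_caratheodory[g [gE gc gx]].
have : g y @[y --> within A x^'] --> l.
  by rewrite -gx; do 2 apply: cvg_within_filter; exact: gc.
apply: cvg_trans; apply: near_eq_cvg.
rewrite near_withinE; near=> y => Ay.
rewrite gE mulfK// subr_eq0; near: y.
exact: nbhs_dnbhs_neq.
Unshelve. all: by end_near. Qed.

Lemma is_derive_derivative_on a b f x l : a < b -> a <= x <= b ->
  is_derive x 1 f l -> derivative_on `[a, b] f x = l.
Proof.
move=> ab xab /(is_derive_quotients_on `[a, b]) fl.
have := within_itv_dnbhs_proper ab xab => ?.
exact: cvg_lim fl.
Qed.

(** At interior points a relative derivative is an ordinary one. *)
Lemma differentiable_on_is_derive a b f : differentiable_on `[a, b] f ->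
  forall x, x \in `]a, b[ -> is_derive x 1 f (derivative_on `[a, b] f x).
Proof.
move=> df x xab; have xab' : `[a, b]%classic x by exact: subset_itv_oo_cc.
have := df _ xab'; rewrite -/(derivative_on _ _ _).
set l := derivative_on _ f x => fl.
apply/is_derive1_caratheodory.
exists (fun z => if z == x then l else (f z - f x) / (z - x)); split.
- move=> z; case: eqP => [->|/eqP]; first by rewrite !subrr mulr0.
  by rewrite -subr_eq0 => /divfK->.
- apply/continuous_withinNx; rewrite eqxx.
  have : (f y - f x) / (y - x) @[y --> x^'] --> l.
    apply: cvg_trans fl => /=; apply: cvg_app => P.
    rewrite /within/= => xP; near=> y.
    suff : `[a, b]%classic y by near: y; exact: xP.
    apply: subset_itv_oo_cc; near: y.
    by apply: (@cvg_within _ (nbhs x)); exact: near_in_itvoo.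
  apply: cvg_trans; apply: near_eq_cvg; near=> y.
  by rewrite ifN//; near: y; exact: nbhs_dnbhs_neq.
- by rewrite eqxx.
Unshelve. all: by end_near. Qed.

Lemma differentiable_on_continuous A f : differentiable_on A f ->
  {within A, continuous f}.
Proof.
move=> df; apply/subspace_continuousP => x Ax.
have := df _ Ax; rewrite -/(derivative_on _ _ _).
move=> /cvgrPdist_lt /(_ _ ltr01); set l := derivative_on _ _ _.
rewrite near_withinE /= near_withinE => fl.
apply/cvgrPdist_lt => e e0; rewrite near_withinE.
pose K := `|l| + 1.
have K0 : 0 < K by rewrite ltr_wpDl.
near=> y => Ay.
have [->|yx] := eqVneq y x; first by rewrite subrr normr0.
have q : `|l - (f y - f x) / (y - x)| < 1.
  suff H : y != x -> A y -> `|l - (f y - f x) / (y - x)| < 1 by exact: H.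
  by near: y; exact: fl.
have yxd : `|x - y| < e / K.
  by near: y; apply: (@cvgr_dist_lt _ R^o) => //; exact: divr_gt0.
have yx0 : y - x != 0 by rewrite subr_eq0.
rewrite distrC -[f y - f x](divfK yx0) normrM.
apply: (@le_lt_trans _ _ (K * `|y - x|)).
  rewrite ler_wpM2r// -[X in `|X|](subrK l) (le_trans (ler_normD _ _))//.
  by rewrite addrC lerD2l distrC ltW.
by rewrite mulrC -ltr_pdivlMr// distrC.
Unshelve. all: by end_near. Qed.

(** The derivative is bounded since it is absolutely continuous, so f is
    Lipschitz by the mean value theorem. *)
Lemma differentiable_on_lac a b f : differentiable_on `[a, b] f ->
  list_absolutely_continuous a b (derivative_on `[a, b] f) ->
  list_absolutely_continuous a b f.
Proof.
move=> df /lac_bounded[M M0 dfM]; apply: (@lac_lipschitz _ _ _ _ M).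
move=> x y ax xy yb.
have [| |z] := @MVT R f (derivative_on `[a, b] f) x y xy.
- move=> z; rewrite in_itv/= => /andP[xz zy].
  apply: differentiable_on_is_derive => //.
  by rewrite in_itv/= (le_lt_trans ax xz) (lt_le_trans zy yb).
- apply: continuous_subspaceW (differentiable_on_continuous df).
  move=> z; rewrite /= !in_itv/= => /andP[xz zy].
  by rewrite (le_trans ax xz) (le_trans zy yb).
- rewrite in_itv/= => /andP[xz zy] ->.
  by rewrite normrM ler_wpM2r// dfM ?(le_trans ax (ltW xz))// (le_trans (ltW zy)).
Qed.

End derivatives_on.

(** * Calculus tools *)

Section real_derivatives.
Context {R : realType}.
Implicit Types (a b c x y : R) (f g h : R -> R).

Lemma continuous_dist c : continuous (fun x : R => `|x - c|).
Proof.
move=> x; apply: (@continuous_comp _ _ _ (fun t => t - c) Num.norm).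
  by apply: cvgB; [exact: cvg_id|exact: cvg_cst].
exact: norm_continuous.
Qed.

(** The primitive of the distance to c, from which all primitives of
    polynomials in t - c and its absolute value are built. *)
Global Instance is_derive1_signed_square c x :
  is_derive x 1 (fun t => `|t - c| * (t - c)) (2 * `|x - c|).
Proof.
have dsq : is_derive x 1 (fun t => (t - c) ^+ 2) (2 * (x - c)).
  by apply: is_derive_eq; rewrite /GRing.scale/=; ring.
have [xc|cx|->] := ltgtP x c.
- rewrite ltr0_norm ?subr_lt0//.
  apply: (@near_eq_is_derive _ _ _ (fun t => 0 - (t - c) ^+ 2)).
    near=> t; rewrite ltr0_norm; first by ring.
    by rewrite subr_lt0; near: t; exact: lt_nbhsl.
  by apply: is_derive_eq; ring.
- rewrite gtr0_norm ?subr_gt0//.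
  apply: near_eq_is_derive dsq.
  near=> t; rewrite gtr0_norm; first by ring.
  by rewrite subr_gt0; near: t; exact: lt_nbhsr.
(* At c the slope of the function is the distance to c, which tends to 0. *)
- apply/is_derive1_caratheodory; exists (fun t => `|t - c|); split.
  + by move=> z; rewrite subrr mulr0 subr0.
  + exact: continuous_dist.
  + by rewrite subrr normr0 mulr0.
Unshelve. all: by end_near. Qed.

Lemma Rintegral_FTC2 (F f : R -> R) a b : a < b ->
  (forall x, is_derive x 1 F (f x)) -> continuous f ->
  \int[lebesgue_measure]_(x in `[a, b]) f x = F b - F a.
Proof.
move=> ab dF cf; rewrite /Rintegral (@continuous_FTC2 _ f F)//.
- exact: continuous_subspaceT.
- have cF x : {for x, continuous F}.
    by apply: differentiable_continuous; apply/derivable1_diffP; case: (dF x).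
  split.
  + by move=> x _; case: (dF x).
  + by apply: cvg_at_right_filter; exact: cF.
  + by apply: cvg_at_left_filter; exact: cF.
- by move=> x _; rewrite derive1E; case: (dF x).
Qed.

End real_derivatives.

(** * The Cauchy-Schwarz inequality for covariances on the unit interval *)

Section integrals.
Context {R : realType}.
Implicit Types (a b c x y : R) (f g h : R -> R).

Local Notation lambda := (@lebesgue_measure R).
Local Notation int01 f := (lambda.-integrable `[0, 1] (EFin \o f)).
Local Notation "'E[' f ]" := (\int[lambda]_(x in `[0, 1]) f x).

Lemma integrable_comb (D : set R) f g a b : measurable D ->
  lambda.-integrable D (EFin \o f) -> lambda.-integrable D (EFin \o g) ->
  lambda.-integrable D (EFin \o (fun x => a * f x + b * g x)).
Proof.
move=> mD fi gi.
rewrite (_ : _ \o _ =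
  (fun x => a%:E * (EFin \o f) x + b%:E * (EFin \o g) x)%E)//.
by apply: integrableD => //; exact: integrableZl.
Qed.

Lemma Rintegral_comb (D : set R) f g a b : measurable D ->
  lambda.-integrable D (EFin \o f) -> lambda.-integrable D (EFin \o g) ->
  \int[lambda]_(x in D) (a * f x + b * g x) =
  a * \int[lambda]_(x in D) f x + b * \int[lambda]_(x in D) g x.
Proof.
move=> mD fi gi; rewrite RintegralD// ?RintegralZl//.
  by rewrite (_ : _ \o _ = (fun x => a%:E * (EFin \o f) x)%E)//; exact: integrableZl.
by rewrite (_ : _ \o _ = (fun x => b%:E * (EFin \o g) x)%E)//; exact: integrableZl.
Qed.

Lemma integrable_itvcc_cst c : int01 (fun=> c).
Proof.
apply: continuous_compact_integrable; first exact: segment_compact.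
by apply: continuous_subspaceT => x; exact: cvg_cst.
Qed.

Lemma Rintegral01_cst c : E[fun=> c] = c.
Proof.
rewrite Rintegral_cst//= lebesgue_measure_itv/= lte_fin ltr01.
by rewrite -EFinD/= subr0 mulr1.
Qed.

Definition variance01 f := E[fun x => f x ^+ 2] - E[f] ^+ 2.

(** For all s and c the integral of the square of d - s k - c is nonnegative.
    It is least when c is the mean of d - s k and s is the regression
    coefficient of d on k, where it gives the claim. *)
Lemma covariance01_le k d : int01 k -> int01 d -> int01 (fun x => k x * d x) ->
  int01 (fun x => k x ^+ 2) -> int01 (fun x => d x ^+ 2) ->
  0 < variance01 k ->
  (E[fun x => k x * d x] - E[k] * E[d]) ^+ 2 <= variance01 k * variance01 d.
Proof.
move=> ki di kdi k2i d2i; rewrite /variance01.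
set k1 := E[k]; set d1 := E[d]; set kd := E[fun x => k x * d x].
set k2 := E[fun x => k x ^+ 2]; set d2 := E[fun x => d x ^+ 2] => V0.
have sq (s c : R) : 0 <= d2 + s ^+ 2 * k2 + c ^+ 2 - 2 * s * kd - 2 * c * d1
    + 2 * s * c * k1.
  have := @Rintegral_ge0 _ _ _ lambda `[0, 1]%classic
    (fun x => (d x - s * k x - c) ^+ 2) (fun x _ => sqr_ge0 _).
  rewrite (_ : (fun x => _) = (fun x =>
    1 * (1 * (1 * d x ^+ 2 + s ^+ 2 * k x ^+ 2) + (- 2 * s) * (k x * d x)) +
    1 * (1 * ((- 2 * c) * d x + (2 * s * c) * k x) + 1 * c ^+ 2))); last first.
    by apply/funext => x; ring.
  have mD : measurable (`[0, 1]%classic : set R) by exact: measurable_itv.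
  have i1 := integrable_comb 1 (s ^+ 2) mD d2i k2i.
  have i2 := integrable_comb 1 (- 2 * s) mD i1 kdi.
  have i3 := integrable_comb (- 2 * c) (2 * s * c) mD di ki.
  have i4 := integrable_comb 1 1 mD i3 (integrable_itvcc_cst (c ^+ 2)).
  rewrite (Rintegral_comb _ _ mD i2 i4) (Rintegral_comb _ _ mD i1 kdi).
  rewrite (Rintegral_comb _ _ mD d2i k2i).
  rewrite (Rintegral_comb _ _ mD i3 (integrable_itvcc_cst _)).
  rewrite (Rintegral_comb _ _ mD di ki) Rintegral01_cst.
  rewrite -/k1 -/d1 -/k2 -/d2 -/kd => h; apply: (le_trans h).
  by rewrite le_eqVlt; apply/orP; left; apply/eqP; ring.
pose V := k2 - k1 ^+ 2; pose C := kd - k1 * d1.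
have := sq (C / V) (d1 - C / V * k1).
have V0' : V != 0 by rewrite gt_eqF.
rewrite (_ : _ + _ = d2 - d1 ^+ 2 - C ^+ 2 / V); last first.
  by rewrite /C /V; field.
by rewrite subr_ge0 ler_pdivrMr// mulrC.
Qed.

End integrals.

(** * Integration by parts against a quadratic polynomial *)

Section by_parts.
Context {R : realType}.
Implicit Types (a b c x y : R) (f g h d : R -> R).

Local Notation lambda := (@lebesgue_measure R).

Lemma eq_ae_Rintegral_itv a b f g :
  measurable_fun `]a, b[ f -> measurable_fun `]a, b[ g ->
  {ae lambda, forall x, x \in `]a, b[ -> f x = g x} ->
  \int[lambda]_(x in `[a, b]) f x = \int[lambda]_(x in `[a, b]) g x.
Proof.
move=> mf mg fg; rewrite /Rintegral.
rewrite [in LHS]integral_itv_bndoo; last exact/measurable_EFinP.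
rewrite [in RHS]integral_itv_bndoo; last exact/measurable_EFinP.
congr fine; apply: ae_eq_integral => //.
- exact/measurable_EFinP.
- exact/measurable_EFinP.
- move: fg; apply: filterS; first exact: (ae_filter_ringOfSetsType lambda).
  by move=> x /= fg xab; rewrite fg.
Qed.

Lemma integrable_itvoo_itvcc a b f : lambda.-integrable `]a, b[ (EFin \o f) ->
  lambda.-integrable `[a, b] (EFin \o f).
Proof.
move=> /integrableP[/measurable_EFinP mf foo]; apply/integrableP; split.
  by apply/measurable_EFinP; exact: measurable_fun_itv_cc mf.
rewrite integral_itv_bndoo//; apply: measurableT_comp => //.
exact/measurable_EFinP.
Qed.

Lemma lac_quadratic a b (al be : R) :
  list_absolutely_continuous a b (fun x => (x - al) ^+ 2 / 2 + be).
Proof.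
have lin (c : R) : list_absolutely_continuous a b (fun x => c * (x - al)).
  apply: (@lac_lipschitz _ _ _ _ `|c|) => x y _ _ _.
  by rewrite -mulrBr normrM (_ : y - al - (x - al) = y - x)//; ring.
have := lacM (lin 1) (lin (1 / 2)).
set u := (_ \* _) => acu; apply: (@lac_le _ _ _ _ u u 1 0) => // x y _ _ _.
rewrite mul1r mul0r addr0 (_ : _ - _ = u y - u x)//.
by rewrite /u/=; field.
Qed.

(** With P x := (x - al)^2 / 2 + be, so that P'' = 1, the function P g - P' f is
    absolutely continuous and its derivative is almost everywhere P d - f, the
    two terms P' g cancelling. Such a form lets f appear undifferentiated after a
    single application of [lac_FTC]. *)
Lemma quadratic_by_parts a b (al be : R) f g d : a < b ->
  (forall x, x \in `]a, b[ -> is_derive x 1 f (g x)) ->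
  {ae lambda, forall x, x \in `]a, b[ -> is_derive x 1 g (d x)} ->
  list_absolutely_continuous a b f -> list_absolutely_continuous a b g ->
  measurable_fun `]a, b[ d ->
  \int[lambda]_(x in `[a, b]) (((x - al) ^+ 2 / 2 + be) * d x - f x) =
  ((b - al) ^+ 2 / 2 + be) * g b - (b - al) * f b
  - (((a - al) ^+ 2 / 2 + be) * g a - (a - al) * f a).
Proof.
move=> ab df dg acf acg md.
pose P x := (x - al) ^+ 2 / 2 + be; pose L x := x - al.
pose M := (P \* g) \- (L \* f).
have acL : list_absolutely_continuous a b L.
  apply: (@lac_lipschitz _ _ _ _ 1) => x y _ _ _.
  by rewrite mul1r /L (_ : y - al - (x - al) = y - x)//; ring.
have acM : list_absolutely_continuous a b M.
  by apply: lacB; apply: lacM => //; exact: lac_quadratic.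
have [h [hi hE dM]] := lac_FTC ab acM.
have := hE b (ltW ab) (lexx b); rewrite /M/= => ->.
have mh : measurable_fun `]a, b[ h.
  by apply: measurable_funTS; apply/measurable_EFinP; exact: measurable_int hi.
have mf : measurable_fun `]a, b[ f.
  apply: open_continuous_measurable_fun; first exact: interval_open.
  move=> x; rewrite inE/= => /df[dfx _].
  by apply: differentiable_continuous; exact/derivable1_diffP.
have mP : measurable_fun `]a, b[ P.
  apply: measurable_funTS; apply: continuous_measurable_fun => x.
  apply: differentiable_continuous; apply/derivable1_diffP.
  exact: ex_derive.
apply: eq_ae_Rintegral_itv => //.
  by apply: measurable_funB => //; exact: measurable_funM.
move: dg dM; apply: filterS2; first exact: (ae_filter_ringOfSetsType lambda).
move=> x /= dgx dMx xab; have {}dMx := dMx xab; have {}dgx := dgx xab.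
have dfx := df _ xab.
have dMx' : is_derive x 1 (fun t => P t * g t - L t * f t) (P x * d x - f x).
  by clear dMx; rewrite /P /L; apply: is_derive_eq; rewrite /GRing.scale/=; field.
have <- := @derive_val _ _ _ _ _ _ _ dMx.
by have <- := @derive_val _ _ _ _ _ _ _ dMx'.
Qed.

End by_parts.

(** * The Peano kernel *)

Section kernel.
Context {R : realType}.
Implicit Types (a b c x y : R) (f g h d : R -> R).

Local Notation lambda := (@lebesgue_measure R).
Local Notation int01 f := (lambda.-integrable `[0, 1] (EFin \o f)).
Local Notation "'E[' f ]" := (\int[lambda]_(x in `[0, 1]) f x).

(** The weight sqrt 2 / 8 of the end points in the quadrature rule. *)
Definition end_weight : R := Num.sqrt 2 / 8.

Lemma end_weight_sqr : end_weight ^+ 2 = 1 / 32.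
Proof. by rewrite /end_weight expr_div_n sqr_sqrtr ?ler0n//; field. Qed.

Lemma end_weight_bounds : 0 <= end_weight <= 3 / 16.
Proof.
have w0 : 0 <= end_weight by rewrite divr_ge0// sqrtr_ge0.
by rewrite w0/= leNgt; apply/negP => w5; have := end_weight_sqr; nra.
Qed.

(** The Peano kernel up to a constant, as a single formula symmetric about the
    node 1 / 2. It is also the second derivative of the extremal function. *)
Definition kernel_hump x :=
  (x - 1 / 2) ^+ 2 / 2 + (end_weight - 1 / 2) * `|x - 1 / 2|.

(** The additive constant makes the kernel vanish at 0 and 1. *)
Definition peano_kernel x := kernel_hump x + (1 / 8 - end_weight / 2).

Lemma peano_kernel_left x : x <= 1 / 2 ->
  peano_kernel x = (x - end_weight) ^+ 2 / 2 + - end_weight ^+ 2 / 2.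
Proof.
move=> x2; rewrite /peano_kernel /kernel_hump ler0_norm ?subr_le0//.
by field.
Qed.

Lemma peano_kernel_right x : 1 / 2 <= x ->
  peano_kernel x = (x - (1 - end_weight)) ^+ 2 / 2 + - end_weight ^+ 2 / 2.
Proof.
move=> x2; rewrite /peano_kernel /kernel_hump ger0_norm ?subr_ge0//.
by field.
Qed.

Lemma continuous_kernel_hump : continuous kernel_hump.
Proof.
move=> x; apply: cvgD.
  apply: (@differentiable_continuous _ _ _ x (fun t => (t - 1 / 2) ^+ 2 / 2)).
  apply/derivable1_diffP.
  exact: ex_derive.
by apply: cvgM; [exact: cvg_cst|exact: continuous_dist].
Qed.

Lemma continuous_peano_kernel : continuous peano_kernel.
Proof. by move=> x; apply: cvgD; [exact: continuous_kernel_hump|exact: cvg_cst]. Qed.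

Lemma continuous_sqr f : continuous f -> continuous (fun x => f x ^+ 2).
Proof. by move=> cf x; exact: (@cvgM _ _ _ _ f f _ _ (cf x) (cf x)). Qed.

Lemma continuous_int01 f : continuous f -> int01 f.
Proof.
move=> cf; apply: continuous_compact_integrable; first exact: segment_compact.
exact: continuous_subspaceT.
Qed.

Lemma Rintegral_peano_kernel : E[peano_kernel] = 1 / 24 - end_weight / 4.
Proof.
set w := end_weight.
pose F x := (x - 1 / 2) ^+ 3 / 6
  + (w - 1 / 2) / 2 * (`|x - 1 / 2| * (x - 1 / 2)) + (1 / 8 - w / 2) * x.
have dF x : is_derive x 1 F (peano_kernel x).
  rewrite /F; apply: is_derive_eq.
  by rewrite /GRing.scale/= /peano_kernel /kernel_hump -/w; field.
rewrite (Rintegral_FTC2 ltr01 dF continuous_peano_kernel).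
by rewrite /F ger0_norm ?ler0_norm; [field|lra|lra].
Qed.

Lemma Rintegral_peano_kernel_sqr : E[fun x => peano_kernel x ^+ 2] =
  1 / 320 - end_weight / 32 + end_weight ^+ 2 / 12.
Proof.
set w := end_weight; pose m := w - 1 / 2; pose k := 1 / 8 - w / 2.
pose F x := (x - 1 / 2) ^+ 5 / 20
  + m / 4 * ((x - 1 / 2) ^+ 2 * (`|x - 1 / 2| * (x - 1 / 2)))
  + (m ^+ 2 + k) * (x - 1 / 2) ^+ 3 / 3
  + m * k * (`|x - 1 / 2| * (x - 1 / 2)) + k ^+ 2 * x.
have dF x : is_derive x 1 F (peano_kernel x ^+ 2).
  rewrite /F; apply: is_derive_eq.
  rewrite /GRing.scale/= /peano_kernel /kernel_hump -/w -/m -/k.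
  have : `|x - 1 / 2| ^+ 2 = (x - 1 / 2) ^+ 2 by rewrite real_normK// num_real.
  set s := `|_| => ss.
  rewrite [RHS](_ : _ = ((x - 1 / 2) ^+ 2 / 2 + k) ^+ 2 +
    2 * ((x - 1 / 2) ^+ 2 / 2 + k) * (m * s) + m ^+ 2 * s ^+ 2); last by ring.
  by rewrite ss; field.
rewrite (Rintegral_FTC2 ltr01 dF (continuous_sqr continuous_peano_kernel)).
by rewrite /F ger0_norm ?ler0_norm /m /k; [field|lra|lra].
Qed.

Lemma variance01_peano_kernel :
  variance01 peano_kernel = 47 / 23040 - Num.sqrt 2 / 768.
Proof.
rewrite /variance01 Rintegral_peano_kernel Rintegral_peano_kernel_sqr.
rewrite (_ : Num.sqrt 2 = 8 * end_weight); last by rewrite /end_weight; field.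
have := end_weight_sqr; move: end_weight => w ww.
rewrite [LHS](_ : _ = 1 / 320 - w / 32 - 1 / 576 + w / 48 + w ^+ 2 / 48).
  by rewrite ww; field.
by field.
Qed.

Lemma variance01_peano_kernel_gt0 : 0 < variance01 peano_kernel.
Proof.
rewrite variance01_peano_kernel.
rewrite (_ : Num.sqrt 2 = 8 * end_weight); last by rewrite /end_weight; field.
by have /andP[w0 w5] := end_weight_bounds; lra.
Qed.

End kernel.

(** * The Peano representation of the quadrature error *)

Section peano.
Context {R : realType}.
Implicit Types (a b c x y : R) (f g h d : R -> R).

Local Notation lambda := (@lebesgue_measure R).
Local Notation int01 f := (lambda.-integrable `[0, 1] (EFin \o f)).
Local Notation "'E[' f ]" := (\int[lambda]_(x in `[0, 1]) f x).

Lemma L2_on_measurable a b f : L2_on a b f -> measurable_fun `]a, b[ f.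
Proof.
rewrite /L2_on inE => /andP[/[!inE]/= mf _].
by apply/(measurable_restrictT _ _).2.
Qed.

Lemma L2_on_integrable_sqr a b f : L2_on a b f ->
  lambda.-integrable `[a, b] (EFin \o (fun x => f x ^+ 2)).
Proof.
move=> /Lfun2_integrable_sqr fi; apply: integrable_itvoo_itvcc.
have mI : measurable (`]a, b[%classic : set (measurableTypeR R)).
  exact: measurable_itv.
have := integrableS measurableT mI (@subsetT _ _) fi.
apply: eq_integrable => // x; rewrite inE/= => xab.
by rewrite /patch mem_set.
Qed.

(** Since |f| <= f^2 + 1 and the interval has finite length. *)
Lemma L2_on_integrable f : L2_on 0 1 f -> int01 f.
Proof.
move=> f2; have mI : measurable (`[0, 1]%classic : set R).
  exact: measurable_itv.
have := integrable_comb 1 1 mI (L2_on_integrable_sqr f2)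
  (integrable_itvcc_cst 1).
apply: le_integrable; first exact: mI.
- by apply/measurable_EFinP; exact: measurable_fun_itv_cc (L2_on_measurable f2).
- move=> x _; rewrite /= !mul1r lee_fin.
  rewrite [leRHS]ger0_norm ?addr_ge0 ?sqr_ge0// -(real_normK (num_real (f x))).
  have := normr_ge0 (f x); have := sqr_ge0 (`|f x| - 1); nra.
Qed.

Lemma integrable_mul_sqr f g : measurable_fun `[0 : R, 1] f ->
  measurable_fun `[0 : R, 1] g -> int01 (fun x => f x ^+ 2) ->
  int01 (fun x => g x ^+ 2) -> int01 (fun x => f x * g x).
Proof.
move=> mf mg f2 g2; have mI : measurable (`[0, 1]%classic : set R).
  exact: measurable_itv.
have := integrable_comb 1 1 mI f2 g2; apply: le_integrable; first exact: mI.
- by apply/measurable_EFinP; exact: measurable_funM.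
- move=> x _; rewrite /= !mul1r lee_fin.
  rewrite [leRHS]ger0_norm ?addr_ge0 ?sqr_ge0// normrM.
  rewrite -(real_normK (num_real (f x))) -(real_normK (num_real (g x))).
  have := normr_ge0 (f x); have := normr_ge0 (g x).
  by have := sqr_ge0 (`|f x| - `|g x|); nra.
Qed.

(** Where the density of [lac_FTC] is the derivative of f', it is also the limit
    of difference quotients that defines the second derivative. *)
Lemma lac_deriv2_ae f : list_absolutely_continuous 0 1 (deriv01 f) ->
  {ae lambda, forall x, x \in `]0, 1[ ->
    is_derive x 1 (deriv01 f) (deriv2_01 f x)}.
Proof.
move=> /(lac_FTC ltr01)[h [_ _]].
apply: filterS; first exact: (ae_filter_ringOfSetsType lambda).
move=> x /= dh x01; have {}dh := dh x01.
suff -> : deriv2_01 f x = h x by [].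
apply: is_derive_derivative_on => //.
exact: (subset_itv_oo_cc x01).
Qed.

Lemma Rintegral_deriv2 f : admissible f ->
  E[deriv2_01 f] = deriv01 f 1 - deriv01 f 0.
Proof.
move=> [_ /absolutely_continuous_on_list acg d2].
have [h [hi hE dh]] := lac_FTC ltr01 acg.
rewrite hE//; apply: eq_ae_Rintegral_itv.
- exact: L2_on_measurable.
- by apply: measurable_funTS; apply/measurable_EFinP; exact: measurable_int hi.
move: dh (lac_deriv2_ae acg).
apply: filterS2; first exact: (ae_filter_ringOfSetsType lambda).
move=> x /= dh dg x01; have {}dh := dh x01; have {}dg := dg x01.
have <- := @derive_val _ _ _ _ _ _ _ dh.
by have <- := @derive_val _ _ _ _ _ _ _ dg.
Qed.

Lemma integrable_peano_kernelM f : L2_on 0 1 f ->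
  int01 (fun x => peano_kernel x * f x).
Proof.
move=> f2; apply: integrable_mul_sqr.
- apply: measurable_funTS; exact: continuous_measurable_fun continuous_peano_kernel.
- exact: measurable_fun_itv_cc (L2_on_measurable f2).
- exact/continuous_int01/continuous_sqr/continuous_peano_kernel.
- exact: L2_on_integrable_sqr.
Qed.

(** On each half of [0, 1] the kernel is a quadratic polynomial with second
    derivative 1, so [quadratic_by_parts] applies. The boundary terms in f' at
    1 / 2 cancel since the kernel is continuous there, those at 0 and 1 vanish
    with the kernel, and the drop of its derivative at 1 / 2 yields the weight of
    f (1 / 2). *)
Lemma Q01_peano f : admissible f ->
  Q01 f = E[fun x => peano_kernel x * deriv2_01 f x].
Proof.
move=> [df /absolutely_continuous_on_list acg d2].
set g := deriv01 f; set d := deriv2_01 f; set w : R := end_weight.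
have acf := differentiable_on_lac df acg.
have dgf := differentiable_on_is_derive df.
have md := L2_on_measurable d2.
have dg := lac_deriv2_ae acg.
have fi : int01 f.
  apply: continuous_compact_integrable; first exact: segment_compact.
  exact: differentiable_on_continuous.
have Kdi := integrable_peano_kernelM d2.
pose G x := peano_kernel x * d x - f x.
have Gi : int01 G.
  rewrite (_ : _ \o _ = EFin \o (fun x => 1 * (peano_kernel x * d x) + (-1) * f x)).
    exact: integrable_comb.
  by apply/funext => x /=; rewrite mul1r mulN1r.
have E_G : E[G] = E[fun x => peano_kernel x * d x] - E[f] by exact: RintegralB.
have half0 : (0 : R) < 1 / 2 by lra.
have half1 : (1 / 2 : R) < 1 by lra.
(* One half of the interval, with the piece of the kernel valid there. *)
have parts (a b al be : R) : 0 <= a -> a < b -> b <= 1 ->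
    {in `[a, b], peano_kernel =1 (fun x => (x - al) ^+ 2 / 2 + be)} ->
    \int[lambda]_(x in `[a, b]) G x =
    peano_kernel b * g b - (b - al) * f b
    - (peano_kernel a * g a - (a - al) * f a).
  move=> a0 ab b1 KE.
  have sub x : x \in `]a, b[ -> x \in `]0 : R, 1[.
    rewrite !in_itv/= => /andP[ax xb].
    by rewrite (le_lt_trans a0 ax) (lt_le_trans xb b1).
  have dfab x : x \in `]a, b[ -> is_derive x 1 f (g x) by move=> /sub /dgf.
  have dgab : {ae lambda, forall x, x \in `]a, b[ -> is_derive x 1 g (d x)}.
    move: dg; apply: filterS; first exact: (ae_filter_ringOfSetsType lambda).
    by move=> x /= dgx /sub /dgx.
  rewrite !KE ?in_itv/= ?lexx ?ltW//.
  rewrite -(quadratic_by_parts al be ab dfab dgab (lacS a0 b1 acf)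
    (lacS a0 b1 acg) (measurable_funS (measurable_itv _) sub md)).
  by apply: eq_Rintegral => x; rewrite inE/= => xab; rewrite /G KE.
have KL : {in `[0, 1 / 2], peano_kernel =1
    (fun x => (x - w) ^+ 2 / 2 + - w ^+ 2 / 2)}.
  by move=> x; rewrite in_itv/= => /andP[_]; exact: peano_kernel_left.
have KR : {in `[1 / 2, 1], peano_kernel =1
    (fun x => (x - (1 - w)) ^+ 2 / 2 + - w ^+ 2 / 2)}.
  by move=> x; rewrite in_itv/= => /andP[+ _]; exact: peano_kernel_right.
have left := parts _ _ _ _ (lexx 0) half0 (ltW half1) KL.
have right := parts _ _ _ _ (ltW half0) half1 (lexx 1) KR.
have [K0 K1] : peano_kernel 0 = 0 :> R /\ peano_kernel 1 = 0 :> R.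
  rewrite peano_kernel_left ?peano_kernel_right ?ltW//.
  by split; field.
have split : E[G] =
    \int[lambda]_(x in `[0, 1 / 2]) G x + \int[lambda]_(x in `[1 / 2, 1]) G x.
  have /(_ _ _)/eqP := @Rintegral_itvB R G (BLeft 0) (BRight 1) (1 / 2) Gi.
  rewrite !bnd_simp subr_eq addrC => /(_ (ltW half0) (ltW half1))/eqP ->.
  congr (_ + _); rewrite Rintegral_itv_obnd_cbnd//; apply: integrableS Gi => //.
  by move=> x; rewrite /= !in_itv/= => /andP[x0 ->]; rewrite andbT; lra.
move: split; rewrite left right E_G K0 K1 /Q01 => EKd.
rewrite (_ : Num.sqrt 2 = 8 * w); last by rewrite /w /end_weight; field.
by lra.
Qed.

End peano.

(** * The error bound *)

Section bound.
Context {R : realType}.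
Implicit Types (a b c x y : R) (f g h d : R -> R).

Local Notation lambda := (@lebesgue_measure R).
Local Notation int01 f := (lambda.-integrable `[0, 1] (EFin \o f)).
Local Notation "'E[' f ]" := (\int[lambda]_(x in `[0, 1]) f x).

Lemma sigma01E f : sigma 0 1 f = Num.sqrt (variance01 f).
Proof. by rewrite /sigma /chebyshev_T /variance01 subr0 invr1 !mul1r. Qed.

(** The mean of the kernel is (4 - 3 sqrt 2) / 96: the correction P removes the
    mean of the kernel, leaving a covariance. *)
Lemma P01_peano f : admissible f -> P01 f = E[peano_kernel] * E[deriv2_01 f].
Proof.
move=> /Rintegral_deriv2 ->; rewrite Rintegral_peano_kernel /P01 /end_weight.
by field.
Qed.

Lemma quadrature_bound f : admissible f ->
  `|Q01 f - P01 f| <=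
    Num.sqrt (variance01 peano_kernel) * sigma 0 1 (deriv2_01 f).
Proof.
move=> adf; have [_ _ d2] := adf.
rewrite sigma01E Q01_peano// P01_peano//.
rewrite -sqrtrM ?(ltW variance01_peano_kernel_gt0)// -sqrtr_sqr ler_wsqrtr//.
apply: covariance01_le.
- exact/continuous_int01/continuous_peano_kernel.
- exact: L2_on_integrable.
- exact: integrable_peano_kernelM.
- exact/continuous_int01/continuous_sqr/continuous_peano_kernel.
- exact: L2_on_integrable_sqr.
- exact: variance01_peano_kernel_gt0.
Qed.

End bound.

(** * Sharpness *)

Section sharpness.
Context {R : realType}.
Implicit Types (a b c x y : R) (f g h d : R -> R).

Local Notation lambda := (@lebesgue_measure R).
Local Notation int01 f := (lambda.-integrable `[0, 1] (EFin \o f)).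
Local Notation "'E[' f ]" := (\int[lambda]_(x in `[0, 1]) f x).

Lemma eq_derivative_on a b f g x l : a < b -> a <= x <= b ->
  {in `[a, b], f =1 g} -> is_derive x 1 g l -> derivative_on `[a, b] f x = l.
Proof.
move=> ab xab fg /(is_derive_quotients_on `[a, b]) gl.
have := within_itv_dnbhs_proper ab xab => ?.
apply: cvg_lim => //; apply: cvg_trans gl; apply: near_eq_cvg.
rewrite near_withinE; near=> y => yab.
by rewrite !fg// in_itv.
Unshelve. all: by end_near. Qed.

Lemma lipschitz_absolutely_continuous_on a b f (M : R) :
  (forall x y, a <= x -> x <= y -> y <= b -> `|f y - f x| <= M * (y - x)) ->
  absolutely_continuous_on a b f.
Proof.
move=> fM e e0; have M0 : 0 < `|M| + 1 by rewrite ltr_wpDl.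
exists (e / (`|M| + 1)); first by rewrite divr_gt0.
move=> n x y xy _; rewrite ltr_pdivlMr// => ed.
apply: le_lt_trans ed; rewrite mulr_suml; apply: ler_sum => i _.
have [ax xyi yb] := xy i; rewrite (le_trans (fM _ _ ax xyi yb))// mulrC.
rewrite ler_wpM2l ?subr_ge0//.
by rewrite (le_trans (ler_norm _))// lerDl.
Qed.

Lemma continuous_L2_on a b f g : continuous g ->
  {in `]a, b[, f =1 g} -> L2_on a b f.
Proof.
move=> cg fg; rewrite /L2_on.
have -> : f \_ `]a, b[ = g \_ `]a, b[.
  apply/funext => x; rewrite /patch; case: ifPn => //.
  by rewrite inE => /fg.
have mgI : measurable_fun setT (g \_ `]a, b[).
  apply/(measurable_restrictT _ _).1; first exact: measurable_itv.
  by apply: measurable_funTS; exact: continuous_measurable_fun.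
apply/andP; split; rewrite inE//= /finite_norm unlock.
apply: poweR_lty.
rewrite (_ : (fun x => _) = (EFin \o (fun x => g x ^+ 2)) \_ `]a, b[); last first.
  apply/funext => x; rewrite /patch/=; case: ifPn => _ /=.
    by rewrite powR_mulrn// real_normK// num_real.
  by rewrite normr0 powR0.
rewrite -integral_mkcond; apply: integrable_lty => //.
have : lambda.-integrable `[a, b] (EFin \o (fun x => g x ^+ 2)).
  apply: continuous_compact_integrable; first exact: segment_compact.
  exact/continuous_subspaceT/continuous_sqr.
apply: integrableS; [exact: measurable_itv|exact: measurable_itv|].
exact: subset_itv_oo_cc.
Qed.

(** Equality holds in the Cauchy-Schwarz inequality when f'' is the kernel up to
    an additive constant; this is an explicit second primitive of
    [kernel_hump]. *)
Definition extremal x := (x - 1 / 2) ^+ 4 / 24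
  + (end_weight - 1 / 2) / 6 * ((x - 1 / 2) * (`|x - 1 / 2| * (x - 1 / 2))).

Definition extremal1 x := (x - 1 / 2) ^+ 3 / 6
  + (end_weight - 1 / 2) / 2 * (`|x - 1 / 2| * (x - 1 / 2)).

Lemma is_derive_extremal x : is_derive x 1 extremal (extremal1 x).
Proof.
rewrite /extremal /extremal1; apply: is_derive_eq.
by rewrite /GRing.scale/=; field.
Qed.

Lemma is_derive_extremal1 x : is_derive x 1 extremal1 (kernel_hump x).
Proof.
rewrite /extremal1 /kernel_hump; apply: is_derive_eq.
by rewrite /GRing.scale/=; field.
Qed.

Lemma deriv01_extremal : {in `[0, 1], deriv01 extremal =1 extremal1}.
Proof.
move=> x; rewrite in_itv/= => x01.
exact: is_derive_derivative_on (is_derive_extremal x).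
Qed.

Lemma deriv2_01_extremal : {in `[0, 1], deriv2_01 extremal =1 kernel_hump}.
Proof.
move=> x; rewrite in_itv/= => x01.
exact: (eq_derivative_on ltr01 x01 deriv01_extremal (is_derive_extremal1 x)).
Qed.

Lemma kernel_hump_bound x : 0 <= x <= 1 -> `|kernel_hump x| <= 1.
Proof.
move=> /andP[x0 x1]; rewrite /kernel_hump.
have /andP[w0 w1] := @end_weight_bounds R.
have s0 : 0 <= `|x - 1 / 2| <= 1 / 2 by rewrite normr_ge0 ler_norml; lra.
have ss : (x - 1 / 2) ^+ 2 = `|x - 1 / 2| ^+ 2 by rewrite real_normK// num_real.
rewrite ss ler_norml; move: s0 => /andP[s0 s1].
move: (`|x - 1 / 2|) s0 s1 => s s0 s1.
by apply/andP; split; nra.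
Qed.

Lemma admissible_extremal : admissible extremal.
Proof.
split.
- move=> x _; apply/cvg_ex; exists (extremal1 x).
  exact: is_derive_quotients_on (is_derive_extremal x).
- apply: (@lipschitz_absolutely_continuous_on _ _ _ 1) => x y x0 xy y1.
  have y0 := le_trans x0 xy; have x1 := le_trans xy y1.
  rewrite !deriv01_extremal ?in_itv/= ?x0 ?y0//.
  have [->|xny] := eqVneq x y; first by rewrite !subrr normr0 mulr0.
  have {}xy : x < y by rewrite lt_neqAle xny.
  have [|z] := MVT xy (fun z _ => is_derive_extremal1 z).
    apply: continuous_subspaceT => z; apply: differentiable_continuous.
    by apply/derivable1_diffP; case: (is_derive_extremal1 z).
  rewrite in_itv/= => /andP[xz zy] ->.
  rewrite normrM [X in _ * X]gtr0_norm ?subr_gt0// ler_wpM2r ?subr_ge0 ?(ltW xy)//.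
  by apply: kernel_hump_bound; apply/andP; split; lra.
- apply: (continuous_L2_on continuous_kernel_hump) => x x01.
  by apply: deriv2_01_extremal; exact: (subset_itv_oo_cc x01).
Qed.

Lemma variance01_shift f c : continuous f ->
  variance01 (fun x => f x + c) = variance01 f.
Proof.
move=> cf; have fi := continuous_int01 cf.
have f2i := continuous_int01 (continuous_sqr cf).
have mI : measurable (`[0, 1]%classic : set R) by exact: measurable_itv.
have ci a := @integrable_itvcc_cst R a.
rewrite /variance01.
have -> : E[fun x => f x + c] = E[f] + c.
  rewrite -[in RHS](Rintegral01_cst c) -RintegralD//.
have -> : E[fun x => (f x + c) ^+ 2] = E[fun x => f x ^+ 2] + 2 * c * E[f] + c ^+ 2.
  have i1 := integrable_comb 1 (2 * c) mI f2i fi.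
  transitivity (E[fun x =>
      1 * (1 * f x ^+ 2 + (2 * c) * f x) + 1 * (fun=> c ^+ 2) x]).
    by congr Rintegral; apply/funext => x; ring.
  rewrite (Rintegral_comb _ _ mI i1 (ci _)) (Rintegral_comb _ _ mI f2i fi).
  by rewrite Rintegral01_cst; ring.
by ring.
Qed.

(** The covariance of the kernel with itself up to a constant is its variance. *)
Lemma extremal_quadrature :
  Q01 extremal - P01 extremal = variance01 (@peano_kernel R).
Proof.
have ade := admissible_extremal; have [_ _ d2] := ade.
rewrite Q01_peano// P01_peano//.
set k : R := 1 / 8 - end_weight / 2.
have Ki : int01 (@peano_kernel R) := continuous_int01 continuous_peano_kernel.
have K2i := continuous_int01 (continuous_sqr (@continuous_peano_kernel R)).
have mI : measurable (`[0, 1]%classic : set R) by exact: measurable_itv.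
have hE : {in `[0, 1], deriv2_01 extremal =1 (fun x => peano_kernel x - k)}.
  by move=> x /deriv2_01_extremal ->; rewrite /peano_kernel addrK.
have -> : E[deriv2_01 extremal] = E[peano_kernel] - k.
  rewrite -[in RHS](Rintegral01_cst k) -RintegralB//; last exact: integrable_itvcc_cst.
  by apply: eq_Rintegral => x; rewrite inE => /hE.
have -> : E[fun x => peano_kernel x * deriv2_01 extremal x] =
    1 * E[fun x => peano_kernel x ^+ 2] + (- k) * E[peano_kernel].
  rewrite -(Rintegral_comb _ _ mI K2i Ki).
  by apply: eq_Rintegral => x; rewrite inE => /hE ->; ring.
by rewrite /variance01; ring.
Qed.

Lemma sigma01_extremal :
  sigma 0 1 (deriv2_01 extremal) = Num.sqrt (variance01 (@peano_kernel R)).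
Proof.
rewrite sigma01E; congr Num.sqrt.
rewrite /peano_kernel variance01_shift; last exact: continuous_kernel_hump.
rewrite /variance01; congr (_ - _ ^+ 2).
  by apply: eq_Rintegral => x; rewrite inE => /deriv2_01_extremal ->.
by apply: eq_Rintegral => x; rewrite inE => /deriv2_01_extremal ->.
Qed.

End sharpness.

Theorem theorem15 (R : realType) :
  let C : R := Num.sqrt (47 / 23040 - Num.sqrt 2 / 768) in
  (forall f : R -> R, admissible f ->
     `|Q01 f - P01 f| <= C * sigma 0 1 (deriv2_01 f)) /\
  (forall c : R,
     (forall f : R -> R, admissible f ->
        `|Q01 f - P01 f| <= c * sigma 0 1 (deriv2_01 f)) ->
     C <= c).
Proof.
rewrite -variance01_peano_kernel; split=> [f|c cP]; first exact: quadrature_bound.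
have V0 := @variance01_peano_kernel_gt0 R.
have := cP _ admissible_extremal.
rewrite extremal_quadrature sigma01_extremal gtr0_norm//.
rewrite -{1}(sqr_sqrtr (ltW V0)) expr2 ler_pM2r// sqrtr_gt0//.
Qed.
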